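(* A permutation $\pi$ satisfies $S^3(\pi)=\mathrm{id}$ (i.e. $\pi$ is West-$3$-stack-sortable) if and only if $\pi$ avoids all of the following ten patterns (each written as: underlying classical pattern; set of shaded boxes; decorated region, if any): 1. $23451$; no shaded boxes. 2. $24351$; shaded $\{(2,4),(2,5)\}$. 3. $32451$; shaded $\{(1,3),(1,4),(1,5)\}$. 4. $42351$; shaded $\{(1,4),(1,5),(2,4),(2,5)\}$. 5. $43251$; shaded $\{(1,4),(1,5),(2,3),(2,4),(2,5)\}$. 6. $34251$; shaded $\{(1,3),(1,4),(1,5),(2,4),(2,5)\}$. 7. $362451$; shaded $\{(0,4),(0,5),(1,3),(1,4),(1,5),(1,6),(2,4),(2,6)\}$; decorated region $\{(2,5)\}$. 8. $364251$; shaded $\{(0,4),(0,5),(1,3),(1,4),(1,5),(1,6),(2,4),(2,6),(3,4),(3,5),(3,6)\}$; decorated region $\{(2,5)\}$. 9. $7362451$; shaded $\{(1,4),(1,5),(1,6),(1,7),(2,3),(2,4),(2,5),(2,6),(2,7),(3,4),(3,6),(3,7)\}$; decorated region $\{(3,5)\}$. 10. $7364251$; shaded $\{(1,4),(1,5),(1,6),(1,7),(2,3),(2,4),(2,5),(2,6),(2,7),(3,4),(3,6),(3,7),(4,4),(4,5),(4,6),(4,7)\}$; decorated region $\{(3,5)\}$.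
   Context: Permutations are in one-line notation; $\mathrm{id}$ is the identity permutation. For a sequence $w$ of distinct integers, the stack-sort $S(w)$ is defined by $S(\varepsilon)=\varepsilon$ and $S(\alpha m\beta)=S(\alpha)S(\beta)m$ where $m$ is the largest entry of $w$ (equivalently: read $w$ left to right; before pushing an entry onto a stack, pop to the output all stack entries smaller than it; at the end pop the remaining stack). $S^3=S\circ S\circ S$. A permutation $\pi$ of length $n$ contains the classical pattern $p$ of length $k$ if there are positions $i_1<\dots<i_k$ with $\pi(i_1)\cdots\pi(i_k)$ order-isomorphic to $p$; these entries form an occurrence. For an occurrence with positions $i_1<\dots<i_k$ and values $v_1<\dots<v_k$, set $i_0=v_0=0$, $i_{k+1}=v_{k+1}=n+1$; for $0\le a,b\le k$ the box $(a,b)$ is the set of entries $\pi(x)$ with $i_a<x<i_{a+1}$ and $v_b<\pi(x)<v_{b+1}$. A pattern with shaded boxes $R$ and decorated region $D$ (sets of boxes) occurs in $\pi$ if there is an occurrence of the underlying classical pattern such that every box in $R$ contains no entry of $\pi$, and the entries of $\pi$ lying in the union of the boxes of $D$, read left to right, form a decreasing sequence (i.e. avoid the pattern $12$). $\pi$ avoids a pattern if it has no occurrence of it. *)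

(* Defs.v *)
(* Permutations of length n are sequences of naturals in
   one-line notation that are permutations of [:: 1; 2; ...; n]. Positions and
   values are 1-indexed as in the paper. *)
From mathcomp Require Import all_boot.
Set Implicit Arguments. Unset Strict Implicit. Unset Printing Implicit Defensive.

Definition is_perm (pi : seq nat) : bool := perm_eq pi (iota 1 (size pi)).

Definition idp (n : nat) : seq nat := iota 1 n.

(* Stack-sorting, by the stack algorithm. The stack is a seq whose head is the
   top. Before pushing x, pop (to the output) all stack entries smaller than x,
   i.e. pop while the top is smaller than x; at the end pop the whole stack. *)
Fixpoint stack_sort_aux (st w : seq nat) : seq nat :=
  match w with
  | [::] => st
  | x :: w' =>
      let k := find (fun y => x < y) st in
      take k st ++ stack_sort_aux (x :: drop k st) w'
  end.

Definition stack_sort (w : seq nat) : seq nat := stack_sort_aux [::] w.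

Definition S3 (w : seq nat) : seq nat := stack_sort (stack_sort (stack_sort w)).

Definition ent (pi : seq nat) (x : nat) : nat := nth 0 pi x.-1.

Definition occurrence (pi p idx : seq nat) : Prop :=
  [/\ size idx = size p,
      sorted ltn idx,
      all (fun i => (1 <= i) && (i <= size pi)) idx &
      forall a b, a < size p -> b < size p ->
        (ent pi (nth 0 idx a) < ent pi (nth 0 idx b)) = (nth 0 p a < nth 0 p b)].

Definition ipos (n : nat) (idx : seq nat) (a : nat) : nat :=
  if a == 0 then 0 else if a <= size idx then nth 0 idx a.-1 else n.+1.

Definition vpos (pi idx : seq nat) (b : nat) : nat :=
  let vs := sort leq [seq ent pi i | i <- idx] in
  if b == 0 then 0 else if b <= size vs then nth 0 vs b.-1 else (size pi).+1.

Definition in_box (pi idx : seq nat) (ab : nat * nat) (x : nat) : bool :=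
  let n := size pi in
  [&& ipos n idx ab.1 < x, x < ipos n idx ab.1.+1,
      vpos pi idx ab.2 < ent pi x & ent pi x < vpos pi idx ab.2.+1].

Definition region_entries (pi idx : seq nat) (D : seq (nat * nat)) : seq nat :=
  [seq ent pi x | x <- iota 1 (size pi) & has (fun ab => in_box pi idx ab x) D].

Definition avoids12 (s : seq nat) : bool := pairwise (fun u v => ~~ (u < v)) s.

Record dpattern := DPat { pat : seq nat; shaded : seq (nat * nat); decor : seq (nat * nat) }.

Definition occurs (P : dpattern) (pi : seq nat) : Prop :=
  exists idx : seq nat,
    [/\ occurrence pi (pat P) idx,
        (forall ab, ab \in shaded P ->
           forall x, 1 <= x <= size pi -> ~~ in_box pi idx ab x) &
        avoids12 (region_entries pi idx (decor P))].

Definition avoids (P : dpattern) (pi : seq nat) : Prop := ~ occurs P pi.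

Definition P1 := DPat [:: 2;3;4;5;1] [::] [::].
Definition P2 := DPat [:: 2;4;3;5;1] [:: (2,4);(2,5)] [::].
Definition P3 := DPat [:: 3;2;4;5;1] [:: (1,3);(1,4);(1,5)] [::].
Definition P4 := DPat [:: 4;2;3;5;1] [:: (1,4);(1,5);(2,4);(2,5)] [::].
Definition P5 := DPat [:: 4;3;2;5;1] [:: (1,4);(1,5);(2,3);(2,4);(2,5)] [::].
Definition P6 := DPat [:: 3;4;2;5;1] [:: (1,3);(1,4);(1,5);(2,4);(2,5)] [::].
Definition P7 := DPat [:: 3;6;2;4;5;1]
  [:: (0,4);(0,5);(1,3);(1,4);(1,5);(1,6);(2,4);(2,6)] [:: (2,5)].
Definition P8 := DPat [:: 3;6;4;2;5;1]
  [:: (0,4);(0,5);(1,3);(1,4);(1,5);(1,6);(2,4);(2,6);(3,4);(3,5);(3,6)] [:: (2,5)].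
Definition P9 := DPat [:: 7;3;6;2;4;5;1]
  [:: (1,4);(1,5);(1,6);(1,7);(2,3);(2,4);(2,5);(2,6);(2,7);(3,4);(3,6);(3,7)]
  [:: (3,5)].
Definition P10 := DPat [:: 7;3;6;4;2;5;1]
  [:: (1,4);(1,5);(1,6);(1,7);(2,3);(2,4);(2,5);(2,6);(2,7);(3,4);(3,6);(3,7);
      (4,4);(4,5);(4,6);(4,7)]
  [:: (3,5)].


Example ss_ex : stack_sort [:: 2;3;1] = [:: 2;1;3]. Proof. by []. Qed.
Example ss_ex2 : stack_sort [:: 3;1;2] = [:: 1;2;3]. Proof. by []. Qed.
Example ss_ex3 : stack_sort [:: 4;1;3;2;5] = [:: 1;2;3;4;5]. Proof. by []. Qed.

(* Main.v *)
(** For u < v, one pass of the stack outputs v before u exactly when some entry larger than v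
    lies between v and u. Unfolding the three passes backwards, S3 w is not the identity iff w
    has an obstruction: entries a < b < c < d such that an entry e > d lies between d and a,
    none larger than d between d and c, and every x > c separated from b by an entry larger
    than x is also separated from c by one.

    If nothing larger than c lies between c and b, the possible orders of b, c and d give P1,
    ..., P5. Otherwise the entries larger than c decrease between c and b, starting with their
    maximum m, and each x before c with c < x < m is hidden from c by a larger entry. If m < e
    this gives P6; if m > e it gives P7, ..., P10, according to whether d comes after or before
    b, and whether an entry y > m is needed to hide such x.

    Conversely P1, ..., P5 are obstructions, and so are P6, ..., P10 unless the condition on
    the entries x > c fails, in which case x completes an occurrence of P1 or P3. *)
From mathcomp Require Import all_boot zify.
Require Import Defs.
Set Implicit Arguments. Unset Strict Implicit. Unset Printing Implicit Defensive.

(** * Stack-sorting *)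

Lemma take_find_sorted (x : nat) (s : seq nat) : sorted ltn s ->
  take (find (fun y => x < y) s) s = [seq y <- s | y <= x].
Proof.
rewrite sorted_pairwise; last exact: ltn_trans.
elim: s => //= y s IH /andP[/allP ys /IH {IH}takeE].
case: leqP => [_|xy]; first by rewrite /= takeE.
apply/esym/eqP; rewrite -[_ == _]negbK -has_filter -all_predC.
by apply/allP => z /ys yz; rewrite /= -ltnNge (ltn_trans xy).
Qed.

Lemma drop_find_sorted (x : nat) (s : seq nat) : sorted ltn s ->
  drop (find (fun y => x < y) s) s = [seq y <- s | x < y].
Proof.
rewrite sorted_pairwise; last exact: ltn_trans.
elim: s => //= y s IH /andP[/allP ys /IH {IH}dropE].
case: leqP => [_|xy] //=; congr cons; apply/esym/all_filterP.
by apply/allP => z /ys; apply: ltn_trans.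
Qed.

Lemma is_perm_bounds (p : seq nat) (i : nat) : is_perm p -> i \in p -> 0 < i <= size p.
Proof. by move=> p_perm; rewrite (perm_mem p_perm) mem_iota add1n ltnS. Qed.

Lemma is_perm_uniq (p : seq nat) : is_perm p -> uniq p.
Proof. by move=> p_perm; rewrite (perm_uniq p_perm) iota_uniq. Qed.

Definition pos (w : seq nat) (x : nat) : nat := (index x w).+1.

Lemma pos_ltn_cat (s t : seq nat) (x y : nat) :
  (pos (s ++ t) x < pos (s ++ t) y) =
    if y \in s then pos s x < pos s y else (x \in s) || (pos t x < pos t y).
Proof.
rewrite /pos !index_cat !ltnS; have := index_mem x s; have := index_mem y s.
by case: (x \in s); case: (y \in s); lia.
Qed.

Lemma perm_stack_sort_aux (st w : seq nat) : perm_eq (stack_sort_aux st w) (st ++ w).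
Proof.
elim: w st => [|x w IH] st; first by rewrite cats0.
rewrite -{2}[st](cat_take_drop (find (fun y => x < y) st)) -catA /= perm_cat2l.
by rewrite (permPl (IH _)) perm_sym -[x :: w]cat1s perm_catCA.
Qed.

Lemma perm_stack_sort (w : seq nat) : perm_eq (stack_sort w) w.
Proof. exact: perm_stack_sort_aux. Qed.

Lemma pos_inj (w : seq nat) : {in w &, injective (pos w)}.
Proof. by move=> x y xw yw [/(index_inj 0 xw yw)]. Qed.

Lemma eq_pos (w : seq nat) (x y : nat) :
  x \in w -> y \in w -> (pos w x == pos w y) = (x == y).
Proof. exact: (inj_in_eq (@pos_inj w)). Qed.

Lemma pairwise_posP (r : rel nat) (s : seq nat) : uniq s ->
  reflect {in s &, forall x y, pos s x < pos s y -> r x y} (pairwise r s).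
Proof.
move=> s_uniq; apply: (iffP (@pairwiseP _ r 0 s)) => [r_nth x y xs ys xy|r_pos i j si sj ij].
  by rewrite -(nth_index 0 xs) -(nth_index 0 ys); apply: r_nth; rewrite ?inE ?index_mem.
by apply: r_pos; rewrite ?mem_nth // /pos !index_uniq.
Qed.

Lemma sorted_ltn_posP (s : seq nat) : uniq s ->
  reflect {in s &, forall x y, x < y -> pos s x < pos s y} (sorted ltn s).
Proof.
move=> s_uniq; rewrite (sorted_pairwise ltn_trans).
apply: (iffP (pairwise_posP _ s_uniq)) => mono x y xs ys xy.
  have [//|/(mono _ _ ys xs)|/(pos_inj xs ys) eq_xy] := ltngtP (pos s x) (pos s y); lia.
have [//|/(mono _ _ ys xs)|eq_xy] := ltngtP x y; last rewrite eq_xy in xy; lia.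
Qed.

Lemma sorted_pos_ltnF (s : seq nat) (u v : nat) :
  sorted ltn s -> u \in s -> u < v -> (pos s v < pos s u) = false.
Proof.
move=> s_sorted us uv; apply/negbTE; rewrite -leqNgt.
have [vs|vs] := boolP (v \in s); last by rewrite /pos (memNindex vs) ltnS index_size.
by apply/ltnW/(sorted_ltn_posP (sorted_uniq ltn_trans ltnn s_sorted)).
Qed.

Lemma pos_cons (x : nat) (s : seq nat) (y : nat) :
  pos (x :: s) y = if x == y then 1 else (pos s y).+1.
Proof. by rewrite /pos /=; case: eqP. Qed.

Lemma sorted_push (x : nat) (st : seq nat) :
  sorted ltn st -> sorted ltn (x :: [seq y <- st | x < y]).
Proof.
rewrite !(sorted_pairwise ltn_trans) pairwise_cons filter_all.
exact: pairwise_filter.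
Qed.

Lemma stack_sort_aux_cons (st : seq nat) (x : nat) (w : seq nat) : sorted ltn st ->
  stack_sort_aux st (x :: w) =
    [seq y <- st | y <= x] ++ stack_sort_aux (x :: [seq y <- st | x < y]) w.
Proof. by move=> st_sorted; rewrite /= take_find_sorted // drop_find_sorted. Qed.

(* The entries of the stack st count as lying before those of the unread word w, and z is
   an entry that pops v before u is read. *)
Definition pops_before (st w : seq nat) (v u : nat) : bool :=
  (u \in w) &&
  has (fun z => [&& v < z, (v \in st) || (pos w v < pos w z) & pos w z < pos w u]) w.

Lemma pops_before_push (st w : seq nat) (x v u : nat) :
  x \notin st -> x \notin w -> ~~ ((v <= x) && (v \in st)) ->
  pops_before st (x :: w) v u = pops_before (x :: [seq y <- st | x < y]) w v u.
Proof.
move=> xst xw v_kept; rewrite /pops_before inE /= !pos_cons eqxx.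
have [<-|ux] := eqVneq x u.
  rewrite (negbTE xw) ltnn !andbF /=; apply/negbTE/hasPn => z _.
  by rewrite !pos_cons; apply/negP => /and3P[_ _]; case: eqP.
have -> : [&& v < x, (v \in st) || ((if x == v then 1 else (pos w v).+1) < 1)
    & 1 < (pos w u).+1] = false.
  apply/negbTE/and3P => -[vx]; move: v_kept; rewrite (ltnW vx) => /= /negbTE -> /=.
  by case: eqP.
congr andb; apply: eq_in_has => z zw; rewrite !pos_cons inE mem_filter.
have -> : (x == z) = false by apply: contraNF xw => /eqP ->.
rewrite [v == x]eq_sym; have [<-|xv] := eqVneq x v; first by rewrite ltnS !orbT.
suff -> : (x < v) && (v \in st) = (v \in st) by rewrite !ltnS.
by case: ltngtP v_kept xv => //= _ /negbTE.
Qed.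

Lemma pos_ltn_stack_sort_aux (st w : seq nat) (u v : nat) :
  sorted ltn st -> uniq (st ++ w) -> u \in st ++ w -> v \in st ++ w -> u < v ->
  (pos (stack_sort_aux st w) v < pos (stack_sort_aux st w) u) = pops_before st w v u.
Proof.
elim: w st => [|x w IH] st st_sorted.
  by rewrite cats0 => _ ust vst uv; rewrite sorted_pos_ltnF.
rewrite stack_sort_aux_cons // => uniq_st_w u_in v_in uv.
have uniq_push : uniq ((x :: [seq y <- st | x < y]) ++ w).
  rewrite -[_ ++ w]/([:: x] ++ _ ++ w) uniq_catCA.
  by apply: subseq_uniq uniq_st_w; rewrite cat_subseq ?filter_subseq.
move: uniq_st_w; rewrite cat_uniq => /and3P[_ /hasPn st_disjoint /= /andP[xw _]].
have st_w y : y \in st -> y \notin x :: w by apply: contraL => /st_disjoint.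
have xst : x \notin st by apply: contraL (mem_head x w) => /st_w.
have in_push y : y \in st ++ x :: w -> ~~ ((y <= x) && (y \in st)) ->
    y \in (x :: [seq z <- st | x < z]) ++ w.
  rewrite !mem_cat !inE mem_filter => /or3P[yst|->|->]; rewrite ?orbT //.
  by rewrite yst andbT ltnNge => ->; rewrite orbT.
rewrite pos_ltn_cat !mem_filter; case: (boolP (_ && _)) => [/andP[ux ust]|u_kept].
  rewrite sorted_pos_ltnF ?mem_filter ?ux // /pops_before ?(negbTE (st_w u ust)) //.
  exact: (sorted_filter ltn_trans).
have [/andP[vx vst]|v_kept] := boolP (_ && _).
  have {}vx : v < x by rewrite ltn_neqAle vx andbT; apply: contraNneq xst => <-.
  have ux := ltn_trans uv vx.
  have uw : u \in w.
    move: u_in u_kept; rewrite mem_cat inE (ltnW ux) (ltn_eqF ux) /=.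
    by case: (u \in st).
  by rewrite /pops_before inE uw orbT /= !pos_cons eqxx vst vx (gtn_eqF ux).
by rewrite IH ?sorted_push ?in_push // pops_before_push.
Qed.

Definition separates (w : seq nat) (v u z : nat) : bool :=
  [&& v < z, pos w v < pos w z & pos w z < pos w u].

Definition larger_between (w : seq nat) (v u : nat) : bool := has (separates w v u) w.

Lemma pos_ltn_stack_sort (w : seq nat) (u v : nat) :
  uniq w -> u \in w -> v \in w -> u < v ->
  (pos (stack_sort w) v < pos (stack_sort w) u) = larger_between w v u.
Proof. by move=> w_uniq uw vw uv; rewrite pos_ltn_stack_sort_aux // /pops_before uw. Qed.

Lemma pos_ltn_stack_sortN (w : seq nat) (u v : nat) :
  uniq w -> u \in w -> v \in w -> u < v ->
  (pos (stack_sort w) u < pos (stack_sort w) v) = ~~ larger_between w v u.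
Proof.
move=> w_uniq uw vw uv; rewrite -pos_ltn_stack_sort // -leqNgt [RHS]leq_eqVlt.
by rewrite eq_pos ?(perm_mem (perm_stack_sort w)) // (ltn_eqF uv).
Qed.

Lemma larger_between_stack_sort (w : seq nat) (v u : nat) :
  uniq w -> u \in w -> v \in w -> u < v ->
  larger_between (stack_sort w) v u =
    has (fun z => [&& v < z, ~~ larger_between w z v & larger_between w z u]) w.
Proof.
move=> w_uniq uw vw uv; rewrite /larger_between (perm_has _ (perm_stack_sort w)).
apply: eq_in_has => z zw; rewrite /separates; case: ltnP => //= vz.
by rewrite pos_ltn_stack_sortN // pos_ltn_stack_sort // (ltn_trans uv).
Qed.

(* What makes b precede a in S3 w, unfolding the three passes from the last one back to the
   first: c lies between b and a after two passes, and d between c and a after one. *)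
Definition S3_obstruction (w : seq nat) (a b c d : nat) : Prop :=
  [/\ all (fun v => v \in w) [:: a; b; c; d], sorted ltn [:: a; b; c; d],
      larger_between w d a, ~~ larger_between w d c &
      {in w, forall x, c < x -> larger_between w x b -> larger_between w x c}].

Definition S3_obstructed (w : seq nat) : Prop := exists a b c d, S3_obstruction w a b c d.

Lemma larger_between_stack_sort2P (w : seq nat) (a b : nat) :
  uniq w -> a \in w -> b \in w -> a < b ->
  larger_between (stack_sort (stack_sort w)) b a <->
  exists c d, S3_obstruction w a b c d.
Proof.
move=> w_uniq aw bw ab; have S_mem := perm_mem (perm_stack_sort w).
have S_uniq : uniq (stack_sort w) by rewrite (perm_uniq (perm_stack_sort w)).
rewrite larger_between_stack_sort ?S_mem // (perm_has _ (perm_stack_sort w)).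
split=> [/hasP[c cw /and3P[bc]]|[c [d [/= /and5P[_ _ cw dw _] /= /and4P[_ bc cd _] da dc hide]]]].
  rewrite !larger_between_stack_sort ?(ltn_trans ab bc) // => /hasPn hide.
  case/hasP=> d dw /and3P[cd dc da]; exists c, d.
  split=> //=; rewrite ?aw ?bw ?cw ?dw ?ab ?bc ?cd //.
  by move=> x xw cx xb; have := hide x xw; rewrite cx xb andbT negbK.
apply/hasP; exists c => //; rewrite bc !larger_between_stack_sort ?(ltn_trans ab bc) //=.
apply/andP; split; last by apply/hasP; exists d => //; rewrite cd dc da.
apply/hasPn => x xw; apply/and3P => -[cx xc xb].
by rewrite (hide x xw cx xb) in xc.
Qed.

Lemma S3_idP (w : seq nat) : is_perm w ->
  S3 w = idp (size w) <-> ~ S3_obstructed w.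
Proof.
move=> w_perm; have w_uniq := is_perm_uniq w_perm.
have perm_S2 : perm_eq (stack_sort (stack_sort w)) w.
  exact: perm_trans (perm_stack_sort _) (perm_stack_sort w).
have perm_S3 : perm_eq (S3 w) w := perm_trans (perm_stack_sort _) perm_S2.
have S2_mem := perm_mem perm_S2; have S2_uniq := w_uniq; rewrite -(perm_uniq perm_S2) in S2_uniq.
have pos_S3 a b : a \in w -> b \in w -> a < b -> (pos (S3 w) a < pos (S3 w) b) =
    ~~ larger_between (stack_sort (stack_sort w)) b a.
  by move=> aw bw; apply: pos_ltn_stack_sortN; rewrite ?S2_mem.
have S3_sorted : sorted ltn (S3 w) <-> ~ S3_obstructed w.
  rewrite -(rwP (sorted_ltn_posP _)) ?(perm_uniq perm_S3) //.
  split=> [incr [a [b [c [d obs]]]]|no_obs a b].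
    have [/= /and3P[aw bw _] /= /andP[ab _] _ _ _] := obs.
    have := incr a b; rewrite !(perm_mem perm_S3) pos_S3 // => /(_ aw bw ab) /negP; apply.
    by apply/larger_between_stack_sort2P => //; exists c, d.
  rewrite !(perm_mem perm_S3) => aw bw ab; rewrite pos_S3 //; apply/negP.
  move/larger_between_stack_sort2P => [//|//|//|//|c [d obs]].
  by apply: no_obs; exists a, b, c, d.
rewrite -S3_sorted; split=> [->|sorted_S3]; first exact: iota_ltn_sorted.
apply: (irr_sorted_eq ltn_trans ltnn sorted_S3 (iota_ltn_sorted _ _)).
exact: perm_mem (perm_trans perm_S3 w_perm).
Qed.

(** * Occurrences described by their values *)

Lemma mem_ent (w : seq nat) (i : nat) : 0 < i <= size w -> ent w i \in w.
Proof. by case: i => // i ilt; apply: mem_nth. Qed.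

Lemma entK (w : seq nat) (i : nat) : uniq w -> 0 < i <= size w -> pos w (ent w i) = i.
Proof. by case: i => // i w_uniq ilt; rewrite /pos index_uniq. Qed.

Lemma posK (w : seq nat) (x : nat) : x \in w -> ent w (pos w x) = x.
Proof. exact: nth_index. Qed.

Lemma pos_bounds (w : seq nat) (x : nat) : x \in w -> 0 < pos w x <= size w.
Proof. by rewrite /pos /= index_mem. Qed.

(* The occurrence of p whose increasingly ordered values are us. *)
Definition pattern_word (p us : seq nat) : seq nat := [seq nth 0 us i.-1 | i <- p].

Lemma perm_pattern_word (p us : seq nat) : is_perm p -> size us = size p ->
  perm_eq (pattern_word p us) us.
Proof.
move=> p_perm us_size; rewrite (permPl (perm_map _ p_perm)) -us_size.
by rewrite -[1]addn0 iotaDl -map_comp (map_nth_iota0 0) // take_size.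
Qed.

Lemma sort_pattern_word (p us : seq nat) : is_perm p -> size us = size p -> sorted ltn us ->
  sort leq (pattern_word p us) = us.
Proof.
move=> p_perm us_size us_sorted; apply: (sorted_eq leq_trans anti_leq).
- exact: (sort_sorted leq_total).
- by apply: sub_sorted us_sorted => x y; apply: ltnW.
by rewrite perm_sort perm_pattern_word.
Qed.

Definition in_order (w s : seq nat) : bool := sorted ltn [seq pos w v | v <- s].
Arguments in_order w !s /.

Definition occurs_at (w p us : seq nat) : Prop :=
  [/\ size us = size p, all (fun v => v \in w) us, sorted ltn us &
      in_order w (pattern_word p us)].

Lemma sorted_ltn_nthE (us : seq nat) (i j : nat) : sorted ltn us ->
  i < size us -> j < size us -> (nth 0 us i < nth 0 us j) = (i < j).
Proof.
move=> us_sorted ilt jlt; have mono := sorted_ltn_nth ltn_trans 0 us_sorted.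
have [/mono->|/mono lt_ji|->] // := ltngtP i j; last exact: ltnn.
by apply/negbTE; rewrite -leqNgt ltnW ?lt_ji.
Qed.

Lemma occurrenceP (w p idx : seq nat) : is_perm w -> is_perm p ->
  occurrence w p idx <->
  exists2 us, occurs_at w p us & idx = [seq pos w v | v <- pattern_word p us].
Proof.
move=> /is_perm_uniq w_uniq p_perm; have p_uniq := is_perm_uniq p_perm.
have p_bounds i : i < size p -> 0 < nth 0 p i <= size p.
  by move=> ilt; rewrite is_perm_bounds ?mem_nth.
split=> [[idx_size idx_sorted /allP idx_bounds idx_iso]|[us]].
  pose us := [seq ent w (nth 0 idx (index i p)) | i <- iota 1 (size p)].
  have us_size : size us = size p by rewrite size_map size_iota.
  have index_p i : 0 < i <= size p -> index i p < size p.
    by rewrite index_mem (perm_mem p_perm) mem_iota add1n.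
  have idxE : [seq pos w v | v <- pattern_word p us] = idx.
    rewrite -map_comp; apply: (@eq_from_nth _ 0) => [|j]; rewrite size_map // => jlt.
    have /andP[pj_gt0 pj_le] := p_bounds j jlt.
    have pj_lt : (nth 0 p j).-1 < size p by rewrite prednK.
    rewrite (nth_map 0) //= (nth_map 0) ?size_iota // nth_iota // add1n prednK //.
    by rewrite index_uniq // entK // idx_bounds // mem_nth // idx_size.
  exists us => //; split=> //; last by rewrite /in_order idxE.
    apply/allP => _ /mapP[i + ->]; rewrite mem_iota add1n => /index_p.
    by rewrite -idx_size => /(mem_nth 0)/idx_bounds/mem_ent.
  apply/(sortedP 0) => i; rewrite us_size => ilt; have ilt' := ltnW ilt.
  rewrite !(nth_map 0) ?size_iota ?nth_iota //= idx_iso ?index_p //; try lia.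
  by rewrite !nth_index // (perm_mem p_perm) mem_iota; lia.
case=> us_size /allP us_mem us_sorted idx_sorted ->.
have word_mem v : v \in pattern_word p us -> v \in w.
  by rewrite (perm_mem (perm_pattern_word p_perm us_size)) => /us_mem.
split=> //; first by rewrite !size_map.
  by apply/allP => _ /mapP[v /word_mem/pos_bounds v_bounds ->].
have entE i : i < size p ->
    ent w (nth 0 [seq pos w v | v <- pattern_word p us] i) = nth 0 us (nth 0 p i).-1.
  move=> ilt; rewrite (nth_map 0) ?size_map // posK; first by rewrite (nth_map 0).
  by rewrite word_mem // mem_nth // size_map.
move=> i j ilt jlt; rewrite !entE //.
have /andP[] := p_bounds i ilt; have /andP[] := p_bounds j jlt.
by move=> pj pj' pi pi'; rewrite sorted_ltn_nthE //; lia.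
Qed.

Definition column (w p us : seq nat) (a : nat) : nat :=
  nth (size w).+1 (0 :: [seq pos w v | v <- pattern_word p us]) a.

Definition row (w us : seq nat) (b : nat) : nat := nth (size w).+1 (0 :: us) b.

Definition in_cell (w p us : seq nat) (x : nat) (ab : nat * nat) : bool :=
  [&& column w p us ab.1 < pos w x, pos w x < column w p us ab.1.+1,
      row w us ab.2 < x & x < row w us ab.2.+1].

Definition in_region (w p us : seq nat) (D : seq (nat * nat)) (x : nat) : bool :=
  has (in_cell w p us x) D.

Lemma iposE (n : nat) (idx : seq nat) (a : nat) : ipos n idx a = nth n.+1 (0 :: idx) a.
Proof.
case: a => [|a] //=; rewrite /ipos /=; case: ltnP => a_size; first exact: set_nth_default.
by rewrite nth_default.
Qed.

Lemma vposE (w idx : seq nat) (b : nat) :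
  vpos w idx b = row w (sort leq [seq ent w i | i <- idx]) b.
Proof. exact: (iposE (size w)). Qed.

Lemma in_boxE (w p us : seq nat) (x : nat) (ab : nat * nat) :
  is_perm p -> occurs_at w p us -> x \in w ->
  in_box w [seq pos w v | v <- pattern_word p us] ab (pos w x) = in_cell w p us x ab.
Proof.
move=> p_perm [us_size /allP us_mem us_sorted _] xw.
rewrite /in_box !iposE !vposE posK // -map_comp.
have -> : [seq (ent w \o pos w) v | v <- pattern_word p us] = pattern_word p us.
  rewrite -[RHS]map_id; apply/eq_in_map => v.
  by rewrite (perm_mem (perm_pattern_word p_perm us_size)) => /us_mem/posK.
by rewrite sort_pattern_word.
Qed.

Lemma map_ent_iota (w : seq nat) : [seq ent w i | i <- iota 1 (size w)] = w.
Proof. by rewrite -[1]addn0 iotaDl -map_comp (map_nth_iota0 0) // take_size. Qed.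

Lemma region_entriesE (w p us : seq nat) (D : seq (nat * nat)) :
  is_perm w -> is_perm p -> occurs_at w p us ->
  region_entries w [seq pos w v | v <- pattern_word p us] D = [seq x <- w | in_region w p us D x].
Proof.
move=> w_perm p_perm us_occ; rewrite -{4}[w]map_ent_iota filter_map; congr map.
apply/eq_in_filter => i; rewrite mem_iota add1n ltnS => i_bounds; apply: eq_has => ab.
by rewrite -in_boxE ?entK ?mem_ent ?is_perm_uniq.
Qed.

Lemma pairwise_filterE (T : Type) (r : rel T) (Q : pred T) (s : seq T) :
  pairwise r (filter Q s) = pairwise (fun x y => Q x ==> Q y ==> r x y) s.
Proof.
elim: s => //= x s <-; case: (Q x) => /=; first by rewrite all_filter.
by rewrite all_predT.
Qed.

Lemma avoids12_filterP (w : seq nat) (Q : pred nat) : uniq w ->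
  avoids12 (filter Q w) <->
  {in w &, forall x y, Q x -> Q y -> pos w x < pos w y -> y <= x}.
Proof.
move=> w_uniq; rewrite /avoids12 pairwise_filterE.
split=> [/(pairwise_posP _ w_uniq) desc x y xw yw Qx Qy xy|desc].
  by have := desc x y xw yw xy; rewrite Qx Qy -leqNgt.
apply/(pairwise_posP _ w_uniq) => x y xw yw xy; apply/implyP => Qx; apply/implyP => Qy.
by rewrite -leqNgt; apply: desc.
Qed.

Lemma occursP (P : dpattern) (w : seq nat) : is_perm w -> is_perm (pat P) ->
  occurs P w <->
  exists us, [/\ occurs_at w (pat P) us,
    {in w, forall x, ~~ in_region w (pat P) us (shaded P) x} &
    {in w &, forall x y, in_region w (pat P) us (decor P) x ->
       in_region w (pat P) us (decor P) y -> pos w x < pos w y -> y <= x}].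
Proof.
move=> w_perm p_perm; have w_uniq := is_perm_uniq w_perm.
split=> [[idx [/occurrenceP[//|//|us us_occ ->] unshaded]]|[us [us_occ unshaded decreasing]]].
  rewrite region_entriesE // => /(avoids12_filterP _ w_uniq) decreasing.
  exists us; split=> // x xw; apply/hasPn => ab ab_shaded.
  by rewrite -in_boxE //; apply/unshaded => //; apply: pos_bounds.
exists [seq pos w v | v <- pattern_word (pat P) us]; split.
- by apply/(occurrenceP _ w_perm p_perm); exists us.
- move=> ab ab_shaded x x_bounds; rewrite -[x](entK w_uniq) // in_boxE ?mem_ent //.
  by have /hasPn := unshaded _ (mem_ent x_bounds); apply.
- by rewrite region_entriesE //; apply/avoids12_filterP.
Qed.

Lemma homo_nth_sorted (n : nat) (s : seq nat) : sorted leq s -> all (fun x => x <= n) s ->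
  {homo nth n s : i j / i <= j}.
Proof.
move=> s_sorted /allP s_le i j ij; have [jlt|jge] := ltnP j (size s).
  by rewrite (sorted_leq_nth leq_trans leqnn n s_sorted) // inE (leq_ltn_trans ij).
by rewrite [leqRHS]nth_default //; have [/(mem_nth n)/s_le|/(nth_default n) ->] := ltnP i (size s).
Qed.

Lemma homo_nth_bounded (n : nat) (s : seq nat) : sorted ltn s -> all (fun x => x <= n) s ->
  {homo nth n (0 :: s) : i j / i <= j}.
Proof.
move=> s_sorted s_le; apply: homo_nth_sorted; rewrite //= path_min_sorted; last exact/allP.
by apply: sub_sorted s_sorted => x y; apply: ltnW.
Qed.

(* The run (k, j, l) consists of the l boxes (k, j), ..., (k, j + l - 1) of column k. *)
Definition boxes (runs : seq (nat * nat * nat)) : seq (nat * nat) :=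
  [seq (r.1.1, b) | r <- runs, b <- iota r.1.2 r.2].

Definition in_run (w p us : seq nat) (x : nat) (r : nat * nat * nat) : bool :=
  [&& column w p us r.1.1 < pos w x, pos w x < column w p us r.1.1.+1,
      row w us r.1.2 < x & x < row w us (r.1.2 + r.2)].

Section Runs.
Variables (w p us : seq nat).
Hypotheses (w_perm : is_perm w) (p_perm : is_perm p) (us_occ : occurs_at w p us).

Lemma homo_column : {homo column w p us : i j / i <= j}.
Proof.
have [_ _ _ word_sorted] := us_occ; apply: homo_nth_bounded => //.
by apply/allP => _ /mapP[v _ ->]; rewrite /pos ltnS index_size.
Qed.

Lemma homo_row : {homo row w us : i j / i <= j}.
Proof.
have [_ /allP us_mem us_sorted _] := us_occ; apply: homo_nth_bounded => //.
by apply/allP => v /us_mem/(is_perm_bounds w_perm)/andP[_ /leqW].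
Qed.

Lemma column_notin (k x : nat) :
  column w p us k < pos w x -> pos w x < column w p us k.+1 -> x \notin us.
Proof.
have [us_size _ _ _] := us_occ; rewrite -(perm_mem (perm_pattern_word p_perm us_size)).
move=> pkx pxk; apply/negP => x_word.
have : pos w x = column w p us (index x (pattern_word p us)).+1.
  by rewrite /column /= (nth_map 0) ?index_mem // nth_index.
move=> pos_x; rewrite pos_x in pkx pxk.
have [/homo_column|/homo_column] := leqP (index x (pattern_word p us)).+1 k; lia.
Qed.

Lemma row_neq (x b : nat) : x \in w -> x \notin us -> row w us b != x.
Proof.
move=> xw x_us; have /andP[x_gt0 x_le] := is_perm_bounds w_perm xw.
case: b => [|b]; first by rewrite /row /= eq_sym -lt0n.
rewrite /row /=; have [blt|bge] := ltnP b (size us); last by rewrite nth_default ?gtn_eqF.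
by apply: contraNneq x_us => <-; apply: mem_nth.
Qed.

Lemma has_iota_row (x j l : nat) : x \in w -> x \notin us ->
  has (fun b => row w us b < x < row w us b.+1) (iota j l) = (row w us j < x < row w us (j + l)).
Proof.
move=> xw x_us; elim: l => [|l IH]; first by rewrite addn0 /=; lia.
rewrite -[l.+1]addn1 iotaD has_cat IH /= orbF addn1 addnS.
have := homo_row (leq_addr l j); have := homo_row (leqnSn (j + l)).
by have := row_neq (j + l) xw x_us; lia.
Qed.

Lemma in_region_boxes (runs : seq (nat * nat * nat)) (x : nat) : x \in w ->
  in_region w p us (boxes runs) x = has (in_run w p us x) runs.
Proof.
move=> xw; elim: runs => [|[[k j] l] runs IH] //=.
rewrite -{}IH /in_region /boxes /= has_cat has_map; congr orb.
rewrite /in_run /=.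
have [px|npx] /= := boolP (column w p us k < pos w x); last first.
  by apply/hasPn => b _; rewrite /= /in_cell (negbTE npx).
have [pk|npk] /= := boolP (pos w x < column w p us k.+1); last first.
  by apply/hasPn => b _; rewrite /= /in_cell (negbTE npk) andbF.
rewrite -has_iota_row // ?(column_notin px) //; apply: eq_has => b.
by rewrite /= /in_cell px pk.
Qed.

End Runs.

Lemma occurs_runsP (P : dpattern) (w : seq nat) (runs decor_runs : seq (nat * nat * nat)) :
  is_perm w -> is_perm (pat P) -> shaded P = boxes runs -> decor P = boxes decor_runs ->
  occurs P w <->
  exists us, [/\ occurs_at w (pat P) us,
    {in w, forall x, ~~ has (in_run w (pat P) us x) runs} &
    {in w &, forall x y, has (in_run w (pat P) us x) decor_runs ->
       has (in_run w (pat P) us y) decor_runs -> pos w x < pos w y -> y <= x}].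
Proof.
move=> w_perm p_perm shadedE decorE; rewrite occursP // shadedE decorE.
split=> -[us [us_occ unshaded decreasing]]; exists us; split=> // [x xw|x y xw yw].
- by rewrite -in_region_boxes // unshaded.
- by rewrite -!in_region_boxes //; apply: decreasing.
- by rewrite in_region_boxes // unshaded.
- by rewrite !in_region_boxes //; apply: decreasing.
Qed.

(** * Obstructions *)

Lemma has_arg_max (T : eqType) (f : T -> nat) (Q : pred T) (s : seq T) : has Q s ->
  exists x, [/\ x \in s, Q x & {in s, forall y, Q y -> f y <= f x}].
Proof.
move=> /hasP[x0 x0s Qx0]; pose attained n := has (fun x => Q x && (f x == n)) s.
have attained_f x : x \in s -> Q x -> attained (f x).
  by move=> xs Qx; apply/hasP; exists x; rewrite ?Qx ?eqxx.
have bounded n : attained n -> n <= \max_(x <- s) f x.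
  by case/hasP=> x xs /andP[_ /eqP <-]; apply: leq_bigmax_seq.
case: (ex_maxnP (ex_intro attained _ (attained_f x0 x0s Qx0)) bounded) => n.
case/hasP=> x xs /andP[Qx /eqP <-] x_max; exists x; split=> // y ys Qy.
exact/x_max/attained_f.
Qed.

(* Splitting conjunctions and dropping hypotheses outside linear arithmetic keeps [lia] fast. *)
Ltac arith :=
  repeat match goal with
  | H : forall _ : nat, _ |- _ => clear H
  | H : is_true (_ \in _) |- _ => clear H
  | H : is_true (_ && _) |- _ => case/andP: H => ? ?
  end; lia.

Lemma larger_betweenP (w : seq nat) (v u : nat) :
  reflect (exists2 z, z \in w & [/\ v < z, pos w v < pos w z & pos w z < pos w u])
          (larger_between w v u).
Proof. by apply: (iffP hasP) => -[z zw /and3P]; exists z. Qed.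

Lemma larger_betweenPn (w : seq nat) (v u : nat) :
  reflect {in w, forall z, pos w v < pos w z -> pos w z < pos w u -> z <= v}
          (~~ larger_between w v u).
Proof.
apply: (iffP hasPn) => le_v z zw; first by have := le_v z zw; rewrite /separates; arith.
by rewrite /separates; have := le_v z zw; arith.
Qed.

Lemma larger_betweenF (w : seq nat) (v u : nat) :
  pos w u <= pos w v -> ~~ larger_between w v u.
Proof. by move=> uv; apply/larger_betweenPn => z _; arith. Qed.

Definition chain (w : seq nat) (a b c d e : nat) : Prop :=
  [/\ all (fun v => v \in w) [:: a; b; c; d; e], sorted ltn [:: a; b; c; d; e],
      in_order w [:: d; e; a],
      ~~ larger_between w d c & ~~ larger_between w c b].

Lemma chain_obstructed (w : seq nat) (a b c d e : nat) : chain w a b c d e -> S3_obstructed w.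
Proof.
case=> /= /and5P[aw bw cw dw /andP[ew _]] /and5P[ab bc cd de _] /and3P[pde pea _] dc.
move=> /larger_betweenPn cb; exists a, b, c, d; split=> //=; rewrite ?aw ?bw ?cw ?dw ?ab ?bc ?cd //.
  by apply/larger_betweenP; exists e.
move=> x xw cx /larger_betweenP[z zw [xz pxz pzb]]; apply/larger_betweenP; exists z => //.
by have := cb z zw; have := eq_pos cw zw; split=> //; arith.
Qed.

Lemma increasing_obstructed (w : seq nat) (a b c d e : nat) :
  all (fun v => v \in w) [:: a; b; c; d; e] -> sorted ltn [:: a; b; c; d; e] ->
  in_order w [:: b; c; d; e; a] -> S3_obstructed w.
Proof.
move=> mem_w vals /= /and5P[pbc pcd pde pea _].
apply: (@chain_obstructed w a b c d e); split=> //=; first by rewrite pde pea.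
  exact/larger_betweenF/ltnW.
exact/larger_betweenF/ltnW.
Qed.

Definition in_band (w : seq nat) (l r lo hi x : nat) : bool :=
  [&& pos w l < pos w x, pos w x < pos w r, lo < x & x < hi].

Definition decreasing_above (w : seq nat) (l r lo : nat) : Prop :=
  {in w &, forall x y, pos w l < pos w x -> pos w x < pos w y -> pos w y < pos w r ->
     lo < x -> y < x}.

Definition hidden_before (w : seq nat) (c lo hi : nat) : Prop :=
  {in w, forall x, pos w x < pos w c -> lo < x < hi -> larger_between w x c}.

(* That only the entries above e are required to decrease, and not all those above c, matches
   the decorated regions of P7, ..., P10. *)
Definition peak (w : seq nat) (b c d e m : nat) : Prop :=
  [/\ ~~ larger_between w c m, ~~ larger_between w m b, ~~ larger_between w d b,
      ~~ has (in_band w m b d e) w & decreasing_above w m b e].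

Definition hidden_peak (w : seq nat) (a b c d e m : nat) : Prop :=
  [/\ all (fun v => v \in w) [:: a; b; c; d; e; m], sorted ltn [:: a; b; c; d; e] && (c < m),
      in_order w [:: c; m; b; e; a]
        && in_order w [:: c; d; e],
      peak w b c d e m & hidden_before w c d m].

Section HiddenPeak.
Variables (w : seq nat) (a b c d e m : nat).
Hypothesis peak_w : hidden_peak w a b c d e m.

Lemma hidden_peak_max z : z \in w -> c < z -> pos w c < pos w z -> pos w z < pos w b ->
  (z <= m) && (pos w m <= pos w z).
Proof.
have [/= /and5P[_ _ cw _ /and3P[_ mw _]] _ _ [/larger_betweenPn cm /larger_betweenPn mb _ _ _] _]
  := peak_w.
move=> zw cz pcz pzb; have := cm z zw pcz; have := mb z zw; have := eq_pos zw mw; arith.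
Qed.

(* One of c x d e a and c x z e a is an occurrence of P1. *)
Lemma hidden_peak_increasing x z : x \in w -> z \in w -> c < x -> x < z ->
  pos w c < pos w x -> pos w x < pos w z -> pos w z < pos w b -> S3_obstructed w.
Proof.
move=> xw zw cx xz pcx pxz pzb.
have /andP[zm _] := hidden_peak_max zw (ltn_trans cx xz) (ltn_trans pcx pxz) pzb.
have /andP[_ pmx] := hidden_peak_max xw cx pcx (ltn_trans pxz pzb).
have [/= /and5P[aw bw cw dw /and3P[ew mw _]] /= vals poss [_ _ db free decr] _] := peak_w.
have {}pmx : pos w m < pos w x.
  by rewrite ltn_neqAle pmx andbT eq_pos // gtn_eqF // (leq_trans xz zm).
have [xd|dx|xd] := ltngtP x d; last by have := larger_betweenPn _ _ _ db z zw; rewrite -xd; arith.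
  have [pxd|pdx|/(pos_inj xw dw)] := ltngtP (pos w x) (pos w d); last by arith.
    by apply: (@increasing_obstructed w a c x d e); rewrite /= ?aw ?cw ?xw ?dw ?ew //; arith.
  have z_le_d := larger_betweenPn _ _ _ db z zw (ltn_trans pdx pxz) pzb.
  have zd : z != d by rewrite -(eq_pos zw dw); arith.
  by apply: (@increasing_obstructed w a c x z e); rewrite /= ?aw ?cw ?xw ?zw ?ew //; arith.
have xe : x != e by rewrite -(eq_pos xw ew); arith.
have := hasPn free x xw; rewrite /in_band => e_le_x.
have := decr x z xw zw pmx pxz pzb; arith.
Qed.

Lemma hidden_peak_obstructed : S3_obstructed w.
Proof.
have [/= /and5P[aw bw cw dw /and3P[ew mw _]] /= vals poss _ hide] := peak_w.
have [/hasP[x xw /and3P[cx /larger_betweenP[z zw [xz pxz pzb]] xc]]|/hasPn all_hidden] :=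
  boolP (has (fun x => [&& c < x, larger_between w x b & ~~ larger_between w x c]) w).
  have [pcx|pxc] := ltnP (pos w c) (pos w x).
    exact: (@hidden_peak_increasing x z).
  (* Here x c d e a turns out to be an occurrence of P3. *)
  have eq_xc := eq_pos xw cw; have eq_zc := eq_pos zw cw.
  have z_le_x := larger_betweenPn _ _ _ xc z zw pxz.
  have /andP[zm _] : (z <= m) && (pos w m <= pos w z) by apply: hidden_peak_max => //; arith.
  have xd : x < d.
    have eq_xd := eq_pos xw dw; rewrite ltnNge; apply: contra xc => dx.
    by apply: hide => //; arith.
  apply: (@chain_obstructed w a c x d e); split=> //=; rewrite ?aw ?cw ?xw ?dw ?ew //; try arith.
  by apply: larger_betweenF; arith.
exists a, b, c, d; split=> /=; rewrite ?aw ?bw ?cw ?dw //; try arith.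
- by apply/larger_betweenP; exists e => //; split; arith.
- by apply: larger_betweenF; arith.
- by move=> x xw cx xb; have := all_hidden x xw; rewrite cx xb negbK.
Qed.

End HiddenPeak.

Section Obstruction.
Variables (w : seq nat) (a b c d : nat).
Hypothesis obstruction_w : S3_obstruction w a b c d.

Lemma obstruction_chain : ~~ larger_between w c b -> exists e, chain w a b c d e.
Proof.
have [/= /and5P[aw bw cw dw _] /= /and4P[ab bc cd _] da dc _] := obstruction_w.
move=> cb; have /larger_betweenP[e ew [de pde pea]] := da; exists e; split=> //=.
- by rewrite aw bw cw dw ew.
- by rewrite ab bc cd de.
- by rewrite pde pea.
Qed.

Lemma obstruction_decreasing : decreasing_above w c b c.
Proof.
have [_ _ _ _ hide] := obstruction_w; move=> x y xw yw pcx pxy pyb cx.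
rewrite ltnNge leq_eqVlt -(eq_pos xw yw) (ltn_eqF pxy) /=; apply/negP => xy.
have /larger_betweenP[z _ [_ pxz pzc]] : larger_between w x c.
  by apply: hide => //; apply/larger_betweenP; exists y.
arith.
Qed.

(* Take for m the largest entry between c and b, and replace d by the largest entry with
   value between c and e and position between c and e. *)
Lemma obstruction_hidden_peak : larger_between w c b -> exists d' e m, hidden_peak w a b c d' e m.
Proof.
have [/= /and5P[aw bw cw dw _] /= /and4P[ab bc cd _] da dc hide] := obstruction_w.
have /larger_betweenP[e ew [de pde pea]] := da; have decr := obstruction_decreasing.
case/(has_arg_max id)=> m [mw /and3P[cm pcm pmb] m_max].
have hide_m x : x \in w -> pos w x < pos w c -> c < x < m -> larger_between w x c.
  move=> xw pxc /andP[cx xm]; apply: hide => //; apply/larger_betweenP; exists m => //.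
  by split; arith.
have pbe : pos w b < pos w e.
  have := eq_pos bw ew; suff : ~~ (pos w e < pos w b) by arith.
  by apply: contra dc => peb; apply: hide => //; apply/larger_betweenP; exists e.
pose below_e x := [&& c < x, x < e, pos w c < pos w x & pos w x < pos w e].
have : has below_e w.
  have [me|em] := ltnP m e; apply/hasP; first by exists m => //; rewrite /below_e; arith.
  exists d => //; rewrite /below_e; suff : pos w c < pos w d by arith.
  have := eq_pos cw dw; suff : ~~ (pos w d < pos w c) by arith.
  by apply: contra dc => pdc; apply: hide_m => //; arith.
case/(has_arg_max id)=> d' [d'w /and4P[cd' de' pcd' pde'] d'_max].
exists d', e, m; split=> /=; rewrite ?aw ?bw ?cw ?d'w ?ew ?mw //; try arith.
- split; try (apply/larger_betweenPn || apply/hasPn).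
  + move=> z zw pcz pzm; have := m_max z zw; have := decr z m zw mw; rewrite /separates; arith.
  + by move=> z zw pmz pzb; have := m_max z zw; rewrite /separates /=; arith.
  + by move=> z zw pdz pzb; have := decr d' z d'w zw; arith.
  + by move=> z zw; have := d'_max z zw; rewrite /below_e /in_band /=; arith.
  + by move=> x y xw yw pmx pxy pyb ex; have := decr x y xw yw; arith.
- by move=> x xw pxc /andP[dx xm]; apply: hide_m => //; arith.
Qed.

End Obstruction.

(** * The ten patterns *)

Definition chain_gap (w : seq nat) (b c d x : nat) : bool :=
  separates w d c x || separates w c b x.

Definition apex_gap (w : seq nat) (b c m x : nat) : bool :=
  separates w c m x || separates w m b x.

Definition peak_gap (w : seq nat) (b c d e m x : nat) : bool :=
  [|| apex_gap w b c m x, separates w d b x | in_band w m b d e x].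

Ltac box_arith :=
  rewrite /in_run /column /row /chain_gap /peak_gap /apex_gap /separates /in_band /=; arith.

Lemma occurs_size5P (P : dpattern) (w : seq nat) (runs : seq (nat * nat * nat))
    (gap : nat -> nat -> nat -> nat -> nat -> pred nat) :
  is_perm w -> is_perm (pat P) -> size (pat P) = 5 ->
  shaded P = boxes runs -> decor P = [::] ->
  (forall a b c d e, let us := [:: a; b; c; d; e] in occurs_at w (pat P) us ->
     {in w, forall x, has (in_run w (pat P) us x) runs = gap a b c d e x}) ->
  occurs P w <-> exists a b c d e,
    occurs_at w (pat P) [:: a; b; c; d; e] /\ ~~ has (gap a b c d e) w.
Proof.
move=> w_perm p_perm p_size shadedE decorE runsE.
rewrite (occurs_runsP w_perm p_perm shadedE (decorE : _ = boxes [::])).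
split=> [[us [us_occ unshaded _]]|[a [b [c [d [e [us_occ /hasPn no_gap]]]]]]].
  case: (us_occ) => us_size _ _ _; rewrite p_size in us_size.
  case: us us_size us_occ unshaded => [|a [|b [|c [|d [|e [|? ?]]]]]] // _ us_occ unshaded.
  exists a, b, c, d, e; split=> //; apply/hasPn => x xw.
  by rewrite -(runsE _ _ _ _ _ us_occ) // unshaded.
by exists [:: a; b; c; d; e]; split=> // x xw; rewrite (runsE _ _ _ _ _ us_occ) ?no_gap.
Qed.

(* In each of P1, ..., P5 the shaded boxes express those of the two conditions that do not
   already follow from the order in which b, c, d and e occur. *)
Definition occurs_chained (P : dpattern) (w : seq nat) : Prop :=
  exists a b c d e, occurs_at w (pat P) [:: a; b; c; d; e] /\ ~~ has (chain_gap w b c d) w.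

Lemma occurs_P1 (w : seq nat) : is_perm w -> occurs P1 w <-> occurs_chained P1 w.
Proof.
move=> w_perm; apply: (@occurs_size5P _ _ [::]) => // a b c d e us.
move=> [_ _ vals poss] x xw; move: vals poss; box_arith.
Qed.

Lemma occurs_P2 (w : seq nat) : is_perm w -> occurs P2 w <-> occurs_chained P2 w.
Proof.
move=> w_perm; apply: (@occurs_size5P _ _ [:: (2, 4, 2)]) => // a b c d e us.
move=> [_ _ vals poss] x xw.
move: vals poss (is_perm_bounds w_perm xw); box_arith.
Qed.

Lemma occurs_P3 (w : seq nat) : is_perm w -> occurs P3 w <-> occurs_chained P3 w.
Proof.
move=> w_perm; apply: (@occurs_size5P _ _ [:: (1, 3, 3)]) => // a b c d e us.
move=> [_ _ vals poss] x xw.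
move: vals poss (is_perm_bounds w_perm xw); box_arith.
Qed.

Lemma occurs_P4 (w : seq nat) : is_perm w -> occurs P4 w <-> occurs_chained P4 w.
Proof.
move=> w_perm; apply: (@occurs_size5P _ _ [:: (1, 4, 2); (2, 4, 2)]) => // a b c d e us.
move=> [_ /= /and5P[_ bw _ _ _] vals poss] x xw.
move: vals poss (is_perm_bounds w_perm xw) (eq_pos xw bw); box_arith.
Qed.

Lemma occurs_P5 (w : seq nat) : is_perm w -> occurs P5 w <-> occurs_chained P5 w.
Proof.
move=> w_perm; apply: (@occurs_size5P _ _ [:: (1, 4, 2); (2, 3, 3)]) => // a b c d e us.
move=> [_ _ vals poss] x xw.
move: vals poss (is_perm_bounds w_perm xw); box_arith.
Qed.

Lemma occurs_P6 (w : seq nat) : is_perm w -> occurs P6 w <->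
  exists a b c m e,
    occurs_at w (pat P6) [:: a; b; c; m; e] /\ ~~ has (apex_gap w b c m) w.
Proof.
move=> w_perm; apply: (@occurs_size5P _ _ [:: (1, 3, 3); (2, 4, 2)]) => // a b c m e us.
move=> [_ _ vals poss] x xw.
move: vals poss (is_perm_bounds w_perm xw); box_arith.
Qed.

(* ys is empty for P7 and P8, and is [:: y] for P9 and P10, whose leading entry y is what hides
   from c the earlier entries smaller than m. *)
Definition unscreened (w : seq nat) (c d m : nat) (ys : seq nat) (x : nat) : bool :=
  if ys is y :: _ then [&& pos w y < pos w x, pos w x < pos w c & d < x]
  else [&& pos w x < pos w c, d < x & x < m].

Definition occurs_peaked (P : dpattern) (w : seq nat) : Prop :=
  exists a b c d e m ys, [/\ occurs_at w (pat P) [:: a, b, c, d, e, m & ys],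
    peak w b c d e m & ~~ has (unscreened w c d m ys) w].

Lemma peakE (w : seq nat) (b c d e m : nat) :
  peak w b c d e m <-> ~~ has (peak_gap w b c d e m) w /\ decreasing_above w m b e.
Proof.
have -> : has (peak_gap w b c d e m) w = [|| larger_between w c m, larger_between w m b,
    larger_between w d b | has (in_band w m b d e) w].
  by rewrite -!has_predU; apply: eq_has => x; rewrite /= /peak_gap /apex_gap -orbA.
by rewrite !negb_or; split=> [[-> -> -> -> ?] //|[/and4P[]]].
Qed.

Lemma occurs_peakedP (P : dpattern) (w : seq nat) (runs : seq (nat * nat * nat)) (k j : nat) :
  is_perm w -> is_perm (pat P) -> 5 < size (pat P) ->
  shaded P = boxes runs -> decor P = [:: (k, j)] ->
  (forall a b c d e m ys, let us := [:: a, b, c, d, e, m & ys] in occurs_at w (pat P) us ->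
     {in w, forall x, has (in_run w (pat P) us x) runs =
        peak_gap w b c d e m x || unscreened w c d m ys x} /\
     {in w, forall x, ~~ peak_gap w b c d e m x ->
        in_run w (pat P) us x (k, j, 1) = [&& pos w m < pos w x, pos w x < pos w b & e < x]}) ->
  occurs P w <-> occurs_peaked P w.
Proof.
move=> w_perm p_perm p_size shadedE decorE regionE.
rewrite (occurs_runsP w_perm p_perm shadedE (decorE : _ = boxes [:: (k, j, 1)])).
split=> [[us [us_occ unshaded decr]]|].
  case: (us_occ) => us_size _ _ _; rewrite -us_size in p_size.
  case: us p_size {us_size} us_occ unshaded decr => [|a [|b [|c [|d [|e [|m ys]]]]]] // _ us_occ.
  have [runsE decor_runE] := regionE _ _ _ _ _ _ _ us_occ => unshaded decr.
  have unshadedP x : x \in w -> ~~ peak_gap w b c d e m x /\ ~~ unscreened w c d m ys x.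
    by move=> xw; have := unshaded x xw; rewrite runsE // => /norP[].
  exists a, b, c, d, e, m, ys; split=> //; last by apply/hasPn => x /unshadedP[].
  apply/peakE; split; first by apply/hasPn => x /unshadedP[].
  move=> x y xw yw pmx pxy pyb ex; rewrite ltnNge; apply/negP => xy.
  have [[x_ok _] [y_ok _]] := (unshadedP x xw, unshadedP y yw).
  have := decr x y xw yw; rewrite /= !decor_runE //.
  have := eq_pos xw yw; arith.
case=> a [b [c [d [e [m [ys [us_occ /peakE[no_gap decr] screened]]]]]]].
have [runsE decor_runE] := regionE _ _ _ _ _ _ _ us_occ.
exists [:: a, b, c, d, e, m & ys]; split=> // [x xw|x y xw yw].
  by rewrite runsE //; apply/norP; split; [apply: (hasPn no_gap)|apply: (hasPn screened)].
rewrite /= !decor_runE ?(hasPn no_gap) // !orbF => /and3P[pmx _ ex] /and3P[_ pyb _] pxy.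
by apply/ltnW/decr.
Qed.

Lemma occurs_P7 (w : seq nat) : is_perm w -> occurs P7 w <-> occurs_peaked P7 w.
Proof.
move=> w_perm.
apply: (@occurs_peakedP _ _ [:: (0, 4, 2); (1, 3, 4); (2, 4, 1); (2, 6, 1)] 2 5) => //.
move=> a b c d e m [|? ?] us [//= _ mem_w vals poss]; split=> x xw.
  move: vals poss (is_perm_bounds w_perm xw) (pos_bounds xw); box_arith.
have mw : m \in w by case/and5P: mem_w => _ _ _ _ /and3P[].
move: vals poss (eq_pos xw mw); box_arith.
Qed.

Lemma occurs_P8 (w : seq nat) : is_perm w -> occurs P8 w <-> occurs_peaked P8 w.
Proof.
move=> w_perm.
apply: (@occurs_peakedP _ _
  [:: (0, 4, 2); (1, 3, 4); (2, 4, 1); (2, 6, 1); (3, 4, 3)] 2 5) => //.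
move=> a b c d e m [|? ?] us [//= _ /and5P[_ _ _ dw /and3P[_ mw _]] vals poss]; split=> x xw.
  move: vals poss (is_perm_bounds w_perm xw) (pos_bounds xw) (eq_pos xw dw); box_arith.
move: vals poss (eq_pos xw dw) (eq_pos xw mw); box_arith.
Qed.

Lemma occurs_P9 (w : seq nat) : is_perm w -> occurs P9 w <-> occurs_peaked P9 w.
Proof.
move=> w_perm.
apply: (@occurs_peakedP _ _ [:: (1, 4, 4); (2, 3, 5); (3, 4, 1); (3, 6, 2)] 3 5) => //.
move=> a b c d e m [|y [|? ?]] us [//= _ /and5P[_ _ _ _ /and3P[_ mw _]] vals poss].
split=> x xw.
  move: vals poss (is_perm_bounds w_perm xw); box_arith.
move: vals poss (eq_pos xw mw); box_arith.
Qed.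

Lemma occurs_P10 (w : seq nat) : is_perm w -> occurs P10 w <-> occurs_peaked P10 w.
Proof.
move=> w_perm.
apply: (@occurs_peakedP _ _
  [:: (1, 4, 4); (2, 3, 5); (3, 4, 1); (3, 6, 2); (4, 4, 4)] 3 5) => //.
move=> a b c d e m [|y [|? ?]] us [//= _ /and5P[_ _ _ dw /and3P[_ mw _]] vals poss].
split=> x xw.
  move: vals poss (is_perm_bounds w_perm xw) (eq_pos xw dw); box_arith.
move: vals poss (eq_pos xw dw) (eq_pos xw mw); box_arith.
Qed.

Lemma occurs_at_subseq (w p q us : seq nat) : occurs_at w p us -> subseq q p ->
  in_order w (pattern_word q us).
Proof.
case=> _ _ _ poss q_sub; apply: (subseq_sorted ltn_trans _ poss).
by apply/map_subseq/map_subseq.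
Qed.

Lemma occurs_chained_obstructed (P : dpattern) (w : seq nat) :
  subseq [:: 4; 5; 1] (pat P) -> occurs_chained P w -> S3_obstructed w.
Proof.
move=> dea_sub [a [b [c [d [e [us_occ no_gap]]]]]].
have [dc cb] : ~~ larger_between w d c /\ ~~ larger_between w c b.
  by apply/norP; rewrite -has_predU.
have [_ us_mem us_sorted _] := us_occ; have dea := occurs_at_subseq us_occ dea_sub.
exact: (@chain_obstructed w a b c d e).
Qed.

Lemma chain_occurs (w : seq nat) (a b c d e : nat) : is_perm w -> chain w a b c d e ->
  occurs P1 w \/ occurs P2 w \/ occurs P3 w \/ occurs P4 w \/ occurs P5 w.
Proof.
move=> w_perm [us_mem us_sorted /= dea dc cb].
have no_gap : ~~ has (chain_gap w b c d) w by rewrite has_predU negb_or dc.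
have occ P : size (pat P) = 5 ->
    in_order w (pattern_word (pat P) [:: a; b; c; d; e]) ->
    occurs_chained P w by move=> p_size p_sorted; exists a, b, c, d, e.
move: us_mem us_sorted dc cb => /= /and5P[_ bw cw dw /andP[ew _]] us_sorted.
move=> /larger_betweenPn dc /larger_betweenPn cb.
have pce : pos w c < pos w e by have := dc e ew; have := eq_pos cw ew; arith.
have pbe : pos w b < pos w e by have := cb e ew; have := eq_pos bw ew; arith.
have [pbc|pcb|/(pos_inj bw cw)] := ltngtP (pos w b) (pos w c); last by arith.
  have [pcd|pdc|/(pos_inj cw dw)] := ltngtP (pos w c) (pos w d); last by arith.
    by left; apply/occurs_P1/occ => //=; arith.
  have [pbd|pdb|/(pos_inj bw dw)] := ltngtP (pos w b) (pos w d); last by arith.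
    by right; left; apply/occurs_P2/occ => //=; arith.
  by right; right; right; left; apply/occurs_P4/occ => //=; arith.
have [pcd|pdc|/(pos_inj cw dw)] := ltngtP (pos w c) (pos w d); last by arith.
  have pbd : pos w b < pos w d by have := cb d dw; have := eq_pos bw dw; arith.
  by right; right; left; apply/occurs_P3/occ => //=; arith.
by right; right; right; right; apply/occurs_P5/occ => //=; arith.
Qed.

Lemma occurs_P6_obstructed (w : seq nat) : is_perm w -> occurs P6 w -> S3_obstructed w.
Proof.
move=> w_perm /occurs_P6[//|a [b [c [m [e [[_ /= us_mem us_sorted poss] no_gap]]]]]].
have [cm mb] : ~~ larger_between w c m /\ ~~ larger_between w m b.
  by apply/norP; rewrite -has_predU.
have /larger_betweenPn m_max := mb; move: us_mem => /and5P[aw bw cw mw /andP[ew _]].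
apply: (@hidden_peak_obstructed w a b c m e m).
split; rewrite /= ?aw ?bw ?cw ?mw ?ew //; try arith.
  split=> //; first by apply/hasPn => x xw; have := m_max x xw; rewrite /in_band; arith.
  by move=> x y xw _ pmx pxy pyb ex; have := m_max x xw; arith.
by move=> x _ _; arith.
Qed.

Lemma occurs_peaked_obstructed (P : dpattern) (w : seq nat) :
  subseq [:: 3; 6; 2; 5; 1] (pat P) -> subseq [:: 3; 4; 5] (pat P) ->
  (6 < size (pat P)) ==> subseq [:: 7; 3] (pat P) ->
  occurs_peaked P w -> S3_obstructed w.
Proof.
move=> cmbea_sub cde_sub yc_sub [a [b [c [d [e [m [ys [us_occ us_peak screened]]]]]]]].
have cmbea := occurs_at_subseq us_occ cmbea_sub; have cde := occurs_at_subseq us_occ cde_sub.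
have [us_size /= us_mem us_sorted _] := us_occ.
apply: (@hidden_peak_obstructed w a b c d e m); split=> //.
- by case/and5P: us_mem => /= -> -> -> -> /and3P[-> ->].
- by move: us_sorted; rewrite /=; arith.
- exact/andP.
move=> x xw pxc dxm; case: ys => [|y ys] in cmbea cde us_size us_occ us_mem us_sorted screened *.
  by have := hasPn screened x xw; rewrite /unscreened pxc dxm.
have := occurs_at_subseq us_occ (implyP yc_sub _); rewrite -us_size => /(_ isT) /= yc.
have yw : y \in w by case/and5P: us_mem => _ _ _ _ /and4P[].
have my : m < y by case/and5P: us_sorted => _ _ _ _ /andP[_ /andP[]].
have /andP[dx xm] := dxm; have xy := ltn_trans xm my.
apply/larger_betweenP; exists y => //; split=> //; last by arith.
have := hasPn screened x xw; rewrite /unscreened pxc dx !andbT -leqNgt leq_eqVlt.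
by rewrite eq_pos // (ltn_eqF xy).
Qed.

Lemma hidden_before_screened (w : seq nat) (c d m : nat) :
  c \in w -> m \in w -> pos w c < pos w m -> hidden_before w c d m ->
  ~~ has (unscreened w c d m [::]) w \/
  exists2 y, y \in w & [/\ m < y, pos w y < pos w c & ~~ has (unscreened w c d m [:: y]) w].
Proof.
move=> cw mw pcm hide.
have [/hasP[x xw /and3P[pxc dx xm]]|] := boolP (has (unscreened w c d m [::]) w); last by left.
(* y is the last entry larger than d before c. *)
right; have : has (fun y => (pos w y < pos w c) && (d < y)) w by apply/hasP; exists x; rewrite ?pxc.
case/(has_arg_max (pos w)) => y [yw /andP[pyc dy] y_max]; exists y => //.
have last_y z : z \in w -> pos w y < pos w z -> pos w z < pos w c -> z <= d.
  by move=> zw pyz pzc; have := y_max z zw; rewrite pzc /=; arith.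
split=> //; last first.
  by apply/hasPn => z zw; have := last_y z zw; rewrite /unscreened; arith.
have [//|ym|eq_ym] := ltngtP m y; last by rewrite eq_ym in pcm; arith.
have /larger_betweenP[z zw [yz pyz pzc]] := hide y yw pyc (introT andP (conj dy ym)).
by have := last_y z zw pyz pzc; arith.
Qed.

Lemma hidden_peak_occurs (w : seq nat) (a b c d e m : nat) : is_perm w ->
  hidden_peak w a b c d e m ->
  occurs P6 w \/ occurs P7 w \/ occurs P8 w \/ occurs P9 w \/ occurs P10 w.
Proof.
move=> w_perm [/= /and5P[aw bw cw dw /and3P[ew mw _]] /= vals poss bcdem_peak hide].
have [/larger_betweenPn cm mb _ _ _] := bcdem_peak.
have [me|em|eq_me] := ltngtP m e; last by rewrite eq_me in poss; arith.
  left; apply/occurs_P6 => //; exists a, b, c, m, e; split.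
    by split; rewrite //= ?aw ?bw ?cw ?mw ?ew //; arith.
  by rewrite has_predU negb_or; apply/andP; split=> //; apply/larger_betweenPn.
have pmd : pos w m < pos w d by have := cm d dw; have := eq_pos mw dw; arith.
have occ P ys : size (pat P) = 6 + size ys -> all (fun v => v \in w) ys -> path ltn m ys ->
    in_order w (pattern_word (pat P) [:: a, b, c, d, e, m & ys]) ->
    ~~ has (unscreened w c d m ys) w -> occurs_peaked P w.
  move=> p_size ys_mem ys_sorted p_sorted screened; exists a, b, c, d, e, m, ys; split=> //.
  split=> //=; first by rewrite aw bw cw dw ew mw.
  by rewrite ys_sorted; arith.
have pcm : pos w c < pos w m by arith.
have pbd := eq_pos bw dw.
have [screened|[y yw [my pyc screened]]] := hidden_before_screened cw mw pcm hide.
  have [lt_bd|lt_db] := ltnP (pos w b) (pos w d).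
    by right; left; apply/occurs_P7/(occ P7 [::]) => //=; arith.
  by right; right; left; apply/occurs_P8/(occ P8 [::]) => //=; arith.
have [lt_bd|lt_db] := ltnP (pos w b) (pos w d).
  by do 3!right; left; apply/occurs_P9/(occ P9 [:: y]); rewrite //= ?yw ?my //; arith.
by do 4!right; apply/occurs_P10/(occ P10 [:: y]); rewrite //= ?yw ?my //; arith.
Qed.

Lemma S3_obstructedP (w : seq nat) : is_perm w ->
  S3_obstructed w <->
  occurs P1 w \/ occurs P2 w \/ occurs P3 w \/ occurs P4 w \/ occurs P5 w \/
  occurs P6 w \/ occurs P7 w \/ occurs P8 w \/ occurs P9 w \/ occurs P10 w.
Proof.
move=> w_perm; split=> [[a [b [c [d obs]]]]|].
  have [cb|cb] := boolP (larger_between w c b).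
    have [d' [e [m peak_w]]] := obstruction_hidden_peak obs cb.
    by have := hidden_peak_occurs w_perm peak_w; tauto.
  by have [e chain_w] := obstruction_chain obs cb; have := chain_occurs w_perm chain_w; tauto.
case=> [|[|[|[|[|[|[|[|[|]]]]]]]]].
- by move/(occurs_P1 w_perm); apply: occurs_chained_obstructed.
- by move/(occurs_P2 w_perm); apply: occurs_chained_obstructed.
- by move/(occurs_P3 w_perm); apply: occurs_chained_obstructed.
- by move/(occurs_P4 w_perm); apply: occurs_chained_obstructed.
- by move/(occurs_P5 w_perm); apply: occurs_chained_obstructed.
- exact: occurs_P6_obstructed.
- by move/(occurs_P7 w_perm); apply: occurs_peaked_obstructed.
- by move/(occurs_P8 w_perm); apply: occurs_peaked_obstructed.
- by move/(occurs_P9 w_perm); apply: occurs_peaked_obstructed.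
- by move/(occurs_P10 w_perm); apply: occurs_peaked_obstructed.
Qed.

Theorem theorem3p9 (pi : seq nat) :
  is_perm pi ->
  (S3 pi = idp (size pi) <->
   avoids P1 pi /\ avoids P2 pi /\ avoids P3 pi /\ avoids P4 pi /\ avoids P5 pi /\
   avoids P6 pi /\ avoids P7 pi /\ avoids P8 pi /\ avoids P9 pi /\ avoids P10 pi).
Proof.
move=> pi_perm; rewrite S3_idP // S3_obstructedP // /avoids; tauto.
Qed.
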